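(* Let $A$ be an irreducible non-permutation square matrix with entries in $\{0,1\}$. For any positive real number $r$, there exists an irreducible non-permutation square matrix $B$ with entries in $\{0,1\}$ such that the one-sided topological Markov shifts $(X_A,\sigma_A)$ and $(X_B,\sigma_B)$ are continuously orbit equivalent and $h_{\mathrm{top}}(X_B,\sigma_B)<r$.
   Context: A square matrix $A=[A(i,j)]_{i,j=1}^N$ with nonnegative entries is irreducible if for all $i,j$ there is $n\ge 1$ with $A^n(i,j)>0$; non-permutation means it is not a permutation matrix. For an irreducible non-permutation $N\times N$ matrix $A$ with entries in $\{0,1\}$, the one-sided topological Markov shift $(X_A,\sigma_A)$ consists of the space $X_A$ of all sequences $(x_n)_{n\in\mathbb{N}}$ with $x_n\in\{1,\dots,N\}$ and $A(x_n,x_{n+1})=1$ for all $n\in\mathbb{N}$ (with the relative topology of the product topology on $\{1,\dots,N\}^{\mathbb{N}}$), together with the shift $\sigma_A((x_n)_{n\in\mathbb{N}})=(x_{n+1})_{n\in\mathbb{N}}$. Two such shifts $(X_A,\sigma_A)$ and $(X_B,\sigma_B)$ (the sizes of $A$ and $B$ may differ) are continuously orbit equivalent if there exist a homeomorphism $h:X_A\to X_B$ and continuous maps $k_1,l_1:X_A\to\mathbb{Z}_+$, $k_2,l_2:X_B\to\mathbb{Z}_+$, where $\mathbb{Z}_+=\{0,1,2,\dots\}$ is discrete, such that $\sigma_B^{k_1(x)}(h(\sigma_A(x)))=\sigma_B^{l_1(x)}(h(x))$ for all $x\in X_A$ and $\sigma_A^{k_2(y)}(h^{-1}(\sigma_B(y)))=\sigma_A^{l_2(y)}(h^{-1}(y))$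 for all $y\in X_B$. $h_{\mathrm{top}}(X_B,\sigma_B)$ denotes the topological entropy of the continuous map $\sigma_B$ on the compact space $X_B$. *)

(* Defs.v *)
From HB Require Import structures.
From mathcomp Require Import all_boot all_order all_algebra.
From mathcomp Require Import all_classical all_reals all_analysis.

Set Implicit Arguments.
Unset Strict Implicit.
Unset Printing Implicit Defensive.

Local Open Scope classical_set_scope.
Local Open Scope ring_scope.

Definition zero_one_mx (N : nat) (A : 'M[nat]_N) : Prop :=
  forall i j, A i j = 0%N \/ A i j = 1%N.

Definition irreducible_mx (N : nat) (A : 'M[nat]_N) : Prop :=
  forall i j, exists2 n : nat, (1 <= n)%N & (0 < (A ^+ n) i j)%N.

(* The library's alias [discrete_topology 'I_N] gives the alphabet its discrete
   topology and [prod_topology] the sequence space its product topology; the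
   coercion of a set to the type of its elements ([set_type]) carries the
   relative topology. *)
Definition markov_space (N : nat) (A : 'M[nat]_N) :
    set (prod_topology (fun _ : nat => discrete_topology 'I_N)) :=
  [set x | forall n, A (x n) (x n.+1) = 1%N].

Lemma markov_shift_subproof (N : nat) (A : 'M[nat]_N) (x : markov_space A) :
  (fun n => val x n.+1) \in markov_space A.
Proof. by apply/mem_set => n; exact: (set_mem (valP x)). Qed.

Definition markov_shift (N : nat) (A : 'M[nat]_N) (x : markov_space A) :
    markov_space A :=
  exist _ (fun n => val x n.+1) (markov_shift_subproof x).

Definition continuously_orbit_equivalent
    (N : nat) (A : 'M[nat]_N) (M : nat) (B : 'M[nat]_M) : Prop :=
  exists (h : markov_space A -> markov_space B)
         (hinv : markov_space B -> markov_space A)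
         (k1 l1 : markov_space A -> nat) (k2 l2 : markov_space B -> nat),
    [/\ cancel h hinv, cancel hinv h, continuous h & continuous hinv] /\
    [/\ continuous k1, continuous l1, continuous k2 & continuous l2] /\
    (forall x : markov_space A,
        iter (k1 x) (@markov_shift M B) (h (markov_shift x)) =
        iter (l1 x) (@markov_shift M B) (h x)) /\
    (forall y : markov_space B,
        iter (k2 y) (@markov_shift N A) (hinv (markov_shift y)) =
        iter (l2 y) (@markov_shift N A) (hinv y)).

(* Topological entropy of a continuous self-map of a compact space, following
   Adler, Konheim and McAndrew. *)

Definition open_cover (T : topologicalType) (U : set (set T)) : Prop :=
  (forall W, U W -> open W) /\ \bigcup_(W in U) W = setT.

Definition cover_number (R : realType) (T : Type) (U : set (set T)) : \bar R :=
  ereal_inf [set (n%:R)%:E | n in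
    [set n : nat | exists V : set (set T),
       [/\ V `<=` U, (V #= `I_n)%card & \bigcup_(W in V) W = setT]]].

(* U v f^-1 U v ... v f^-(n-1) U *)
Definition iterated_join (T : Type) (f : T -> T) (U : set (set T)) (n : nat) :
    set (set T) :=
  [set \bigcap_(i in `I_n) (iter i f @^-1` W i) | W in
    [set W : nat -> set T | forall i, U (W i)]].

(* For a continuous map of a compact space the sequence converges, by
   subadditivity, so that the limsup is the limit. *)
Definition cover_entropy (R : realType) (T : Type) (f : T -> T)
    (U : set (set T)) : \bar R :=
  limn_esup (fun n => ((n%:R^-1)%:E *
                       lne (cover_number R (iterated_join f U n)))%E).

Definition topological_entropy (R : realType) (T : topologicalType)
    (f : T -> T) : \bar R :=
  ereal_sup [set cover_entropy R f U | U in @open_cover T].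

(* Main.v *)
Require Import Defs.
From mathcomp Require Import all_boot all_order all_algebra.
From mathcomp Require Import all_classical all_reals all_analysis.
From mathcomp Require Import fingroup perm zify.

Set Implicit Arguments.
Unset Strict Implicit.
Unset Printing Implicit Defensive.

Import Order.TTheory GRing.Theory Num.Theory.

(** Fix a large [n].  A point of [X_A] is a word [w] of [n] letters followed by
    a sequence [y] such that [w] may precede the letter [y 0]; call such words
    the pasts of [y 0].  Cutting every point at [n] thus writes [X_A] as a
    disjoint union, over the letters [j], of as many copies of the cylinder
    [y 0 = j] as [j] has pasts.

    Now replace each letter [j] by a tower with one floor for each past of [j]:
    one climbs a tower floor by floor and, from the top, moves to the ground
    floor of the tower of any letter that may follow [j].  Let [B] be the
    transition matrix of this graph.  A point of [X_B] is determined by its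
    first vertex and by the sequence [y] of towers that it visits, and every
    floor of the tower [y 0] can be the first vertex; so [X_B] is the same
    disjoint union.  Letting the rank of [w] among the pasts of [y 0] be the
    floor on which to start gives the homeomorphism [recode] from [X_A] to
    [X_B].  Shifting a point on either side keeps, or shifts once, the sequence
    [y] and alters only the finite information in front of it, which is
    forgotten in bounded time: hence the continuous orbit equivalence
    ([recode_orbit_equivalence]).

    The entropy is small when the towers are high.  If every letter has at least
    [p] pasts, a point of [X_B] enters a new tower at most every [p] steps, so
    its first [t] vertices are determined by about [t / p] letters of the
    corresponding point of [X_A] ([recode_local]).  There are therefore at most
    [N ^ (t / p + const)] cylinders of length [t], and the entropy is at most
    [ln N / p] ([entropy_le], which passes from cylinders to arbitrary open
    covers by the Lebesgue number lemma).  Finally [p] can be taken arbitrarily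
    large, since the number of pasts of every letter tends to infinity with [n]
    when [A] is irreducible and not a permutation matrix ([pasts_unbounded]). *)

(** * Words preceding a letter *)

Section Pasts.
Variables (N : nat) (A : 'M[nat]_N).

Lemma mulmx_nat_gt0 (B C : 'M[nat]_N) i j :
  (0 < (B *m C)%R i j)%N <-> exists k, (0 < B i k)%N /\ (0 < C k j)%N.
Proof.
rewrite mxE; split => [|[k [Bk Ck]]].
  move=> /lt0n_neq0/eqP sum_neq0; apply: contrapT => nex; apply: sum_neq0.
  apply: big1 => k _; apply/eqP; rewrite -leqn0 leqNgt; apply/negP.
  by rewrite muln_gt0 => /andP[Bk Ck]; apply: nex; exists k.
by rewrite (bigD1 k)//= addn_gt0 muln_gt0 Bk Ck.
Qed.

Lemma exprS_gt0 n i j : (0 < (A ^+ n.+1)%R i j)%N <->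
  exists k, (0 < (A ^+ n)%R i k)%N /\ (0 < A k j)%N.
Proof. by rewrite exprSr; exact: mulmx_nat_gt0. Qed.

Lemma exprD_gt0 m n i k j : (0 < (A ^+ m)%R i k)%N -> (0 < (A ^+ n)%R k j)%N ->
  (0 < (A ^+ (m + n))%R i j)%N.
Proof. by move=> Aik Akj; rewrite exprD; apply/mulmx_nat_gt0; exists k. Qed.

Hypothesis A01 : zero_one_mx A.

Lemma entry_gt0 i j : (0 < A i j)%N -> A i j = 1%N.
Proof. by case: (A01 i j) => ->. Qed.

Hypothesis Airr : irreducible_mx A.

Lemma irreducible_succ i : exists j, A i j = 1%N.
Proof.
have [[//|n] _] := Airr i i; rewrite exprS => /mulmx_nat_gt0[j [/entry_gt0 Aij _]].
by exists j.
Qed.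

Lemma irreducible_pred j : exists i, A i j = 1%N.
Proof.
have [[//|n] _] := Airr j j => /exprS_gt0[i [_ /entry_gt0 Aij]].
by exists i.
Qed.

(** If no column had two ones, choosing a successor of every index would be an
    injective, hence bijective, map, and [A] its permutation matrix. *)
Lemma nonperm_two_preds : ~~ is_perm_mx A ->
  exists i1 i2 j, [/\ i1 != i2, A i1 j = 1%N & A i2 j = 1%N].
Proof.
move=> /negP Anperm; apply: contrapT => noconf; apply: Anperm.
have inj1 i1 i2 j : A i1 j = 1%N -> A i2 j = 1%N -> i1 = i2.
  move=> A1 A2; apply/eqP; apply: contrapT => /negP ne12.
  by apply: noconf; exists i1, i2, j.
have [f Af] := choice irreducible_succ.
have f_inj : injective f.
  by move=> i1 i2 ef; apply: (inj1 _ _ (f i1)) => //; rewrite ef.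
apply/is_perm_mxP; exists (perm f_inj); apply/matrixP => i j; rewrite !mxE.
have [e|ne] := eqVneq; first by rewrite -e permE Af.
case: (A01 i j) => [//|Aij]; case/eqP: ne.
have -> : j = perm f_inj ((perm f_inj)^-1%g j) by rewrite permKV.
congr (perm f_inj _); apply: (inj1 _ _ j) => //.
by rewrite -[X in A _ X](permKV (perm f_inj)) [X in A _ X]permE.
Qed.

(** The words of [n] letters that may precede [j].  Their order has no meaning:
    it serves to number the floors of the tower of [j]. *)
Fixpoint pasts (n : nat) (j : 'I_N) : seq (seq 'I_N) :=
  if n is n'.+1 then
    [seq rcons w i | i <- [seq i <- enum 'I_N | A i j == 1%N], w <- pasts n' i]
  else [:: [::]].

Lemma size_mem_pasts n j w : w \in pasts n j -> size w = n.
Proof.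
elim: n j w => [|n IHn] j w /=; first by rewrite inE => /eqP->.
by case/allpairsPdep => i [v [_ /IHn sv ->]]; rewrite size_rcons sv.
Qed.

Lemma pasts_uniq n j : uniq (pasts n j).
Proof.
elim: n j => [//|n IHn] j /=; apply: allpairs_uniq_dep.
- by rewrite filter_uniq// enum_uniq.
- by [].
- by move=> [i w] [i' w'] _ _ /= /rcons_inj[-> ->].
Qed.

Lemma size_pastsS n j :
  size (pasts n.+1 j) = (\sum_(i | A i j == 1) size (pasts n i))%N.
Proof. by rewrite /= size_allpairs_dep sumnE big_map big_filter big_enum_cond. Qed.

Lemma size_pasts_edge n i j : A i j = 1%N ->
  (size (pasts n i) <= size (pasts n.+1 j))%N.
Proof. by move=> Aij; rewrite size_pastsS (bigD1 i) ?Aij//= leq_addr. Qed.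

Lemma size_pasts_path n d i j : (0 < (A ^+ d)%R i j)%N ->
  (size (pasts n i) <= size (pasts (n + d) j))%N.
Proof.
elim: d j => [|d IHd] j.
  by rewrite expr0 mxE addn0; case: eqP => [->|].
move=> /exprS_gt0[k [/IHd le_ik /entry_gt0 Akj]].
by rewrite addnS (leq_trans le_ik)// size_pasts_edge.
Qed.

Lemma size_pasts_mono p n m : (forall j, (p <= size (pasts n j))%N) ->
  (n <= m)%N -> forall j, (p <= size (pasts m j))%N.
Proof.
move=> pn /subnKC <-; elim: (m - n)%N => [|d IHd] j; first by rewrite addn0.
have [i Aij] := irreducible_pred j.
by rewrite addnS (leq_trans (IHd i))// size_pasts_edge.
Qed.

(** The number of pasts doubles at an index with two predecessors, and
    irreducibility carries the gain to every other index within a time [D]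
    independent of the length. *)
Lemma pasts_unbounded : ~~ is_perm_mx A ->
  forall p, exists n, forall j, (p <= size (pasts n j))%N.
Proof.
move=> /nonperm_two_preds[i1 [i2 [b [ne12 Ai1 Ai2]]]].
have reach j : exists d, (0 < (A ^+ d)%R b j)%N.
  by have [d _ Abj] := Airr b j; exists d.
have [d dP] := choice reach; pose D := (\max_j d j)%N.
suff grow : forall p, exists n, forall j, (p.+1 <= size (pasts n j))%N.
  by case=> [|p]; [exists 0%N|exact: grow].
elim=> [|p [n IHn]]; first by exists 0%N => j.
exists (n.+1 + D)%N => j.
(* [b] has two predecessors, each with at least [p.+1] pasts. *)
have twice m : (n <= m)%N -> (p.+2 <= size (pasts m.+1 b))%N.
  move=> /(size_pasts_mono IHn) low.
  rewrite size_pastsS (bigD1 i1) ?Ai1//= (bigD1 i2) /=; last first.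
    by rewrite Ai2 eqxx eq_sym.
  have := low i1; have := low i2; lia.
have leD : (d j <= D)%N by apply: leq_bigmax.
(* Leave [b] at the date from which [j] is reached in [d j] steps on time. *)
rewrite (leq_trans (twice (n + (D - d j))%N (leq_addr _ _)))//.
have -> : (n.+1 + D = (n + (D - d j)).+1 + d j)%N by lia.
exact: size_pasts_path.
Qed.

(** Prepending a finite word to a sequence; past the word the sequence itself
    serves as the default of [nth]. *)
Definition prepend (w : seq 'I_N) (y : nat -> 'I_N) : nat -> 'I_N :=
  fun i => if (i < size w)%N then nth (y 0%N) w i else y (i - size w)%N.

Definition admissible (y : nat -> 'I_N) := forall i, A (y i) (y i.+1) = 1%N.

(** Moves the last letter of the word to the sequence, so that properties of
    [prepend] follow the recursion of [pasts]. *)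
Lemma prepend_rcons w i y :
  prepend (rcons w i) y = prepend w (fun t => if t is t'.+1 then y t' else i).
Proof.
apply/funext => t; rewrite /prepend size_rcons ltnS nth_rcons.
case: (ltngtP t (size w)) => [lt|gt|->].
- exact: set_nth_default.
- by have -> : (t - size w = (t - (size w).+1).+1)%N by lia.
- by rewrite subnn.
Qed.

Lemma prepend_admissible n w y : admissible y -> w \in pasts n (y 0%N) ->
  admissible (prepend w y).
Proof.
elim: n w y => [|n IHn] w y /= ady.
  rewrite inE => /eqP->; rewrite (_ : prepend _ _ = y)//.
  by apply/funext => i; rewrite /prepend subn0.
case/allpairsPdep => i [v [+ vP ->]]; rewrite mem_filter => /andP[/eqP Ai _].
rewrite prepend_rcons; apply: IHn => //.
by case=> [|t] /=.
Qed.

Lemma mkseq_pasts n x : admissible x -> mkseq x n \in pasts n (x n).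
Proof.
move=> adx; elim: n => [|n IHn]; first by rewrite inE.
rewrite /mkseq -[n.+1]addn1 iotaD map_cat /= add0n cats1 addn1 /=.
apply/allpairsPdep; exists (x n), (mkseq x n); split=> //.
by rewrite mem_filter adx eqxx mem_enum.
Qed.

End Pasts.

(** * The tower graph *)

(** The vertices of the tower graph are the pairs of a letter and a floor.  A
    matrix wants them numbered; [tow], [ht] and [bt] give back the tower, the
    floor, and the vertex on a given floor of a given tower. *)
Lemma tower_coding (N : nat) (P : 'I_N -> nat) (j0 : 'I_N) : (0 < P j0)%N ->
  exists (M : nat) (tow : 'I_M -> 'I_N) (ht : 'I_M -> nat)
         (bt : 'I_N -> nat -> 'I_M),
    [/\ forall j k, (k < P j)%N -> tow (bt j k) = j,
        forall j k, (k < P j)%N -> ht (bt j k) = k,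
        forall b, (ht b < P (tow b))%N
      & forall b, bt (tow b) (ht b) = b].
Proof.
move=> P0; pose V := {j : 'I_N & 'I_(P j)}.
pose v0 : V := Tagged _ (Ordinal P0).
pose bt j k : 'I_#|{: V}| := enum_rank
  (if insub k : option 'I_(P j) is Some o then Tagged (fun j => 'I_(P j)) o else v0 : V).
pose vertex (b : 'I_#|{: V}|) : V := enum_val b.
exists #|{: V}|, (fun b => tag (vertex b)), (fun b => tagged (vertex b) : nat), bt.
split=> [j k lt_k|j k lt_k|b|b].
- by rewrite /bt /vertex insubT enum_rankK.
- by rewrite /bt /vertex insubT enum_rankK.
- exact: ltn_ord.
- rewrite -[RHS]enum_valK -/(vertex b); case: (vertex b) => j k.
  by rewrite /bt /= valK.
Qed.

Section Towers.
Variables (N : nat) (A : 'M[nat]_N) (P : 'I_N -> nat).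
Variables (M : nat) (tow : 'I_M -> 'I_N) (ht : 'I_M -> nat).
Variable bt : 'I_N -> nat -> 'I_M.
Hypothesis bt_tow : forall j k, (k < P j)%N -> tow (bt j k) = j.
Hypothesis bt_ht : forall j k, (k < P j)%N -> ht (bt j k) = k.
Hypothesis ht_lt : forall b, (ht b < P (tow b))%N.
Hypothesis btK : forall b, bt (tow b) (ht b) = b.

Definition tower_edge (b c : 'I_M) : bool :=
  if ((ht b).+1 < P (tow b))%N then (tow c == tow b) && (ht c == (ht b).+1)
  else (A (tow b) (tow c) == 1%N) && (ht c == 0%N).

Definition tower_mx : 'M[nat]_M := \matrix_(b, c) (tower_edge b c : nat).

Lemma tower_mx01 : zero_one_mx tower_mx.
Proof. by move=> b c; rewrite mxE; case: tower_edge; [right|left]. Qed.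

Lemma tower_mxP b c : tower_mx b c = 1%N <-> tower_edge b c.
Proof. by rewrite mxE; case: tower_edge. Qed.

Lemma bt_eq b j k : tow b = j -> ht b = k -> b = bt j k.
Proof. by move=> <- <-; rewrite btK. Qed.

Hypothesis A01 : zero_one_mx A.
Hypothesis P_gt0 : forall j, (0 < P j)%N.

(** If [j] has two predecessors, the ground floor of the tower of [j] is
    accessible from the tops of their two towers. *)
Lemma tower_mx_nonperm : irreducible_mx A -> ~~ is_perm_mx A ->
  ~~ is_perm_mx tower_mx.
Proof.
move=> Airr /(nonperm_two_preds A01 Airr)[i1 [i2 [j [ne12 Ai1 Ai2]]]].
have top i : A i j = 1%N -> tower_mx (bt i (P i).-1) (bt j 0) = 1%N.
  move=> Aij; apply/tower_mxP; have lt_top : ((P i).-1 < P i)%N by rewrite prednK.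
  by rewrite /tower_edge !bt_tow// !bt_ht// prednK// ltnn Aij.
apply/negP => /is_perm_mxP[s Bs]; case/eqP: ne12.
have sE i : A i j = 1%N -> s (bt i (P i).-1) = bt j 0%N.
  by move=> /top; rewrite Bs !mxE; case: eqP.
have := etrans (sE _ Ai1) (esym (sE _ Ai2)); move=> /perm_inj e.
by rewrite -(@bt_tow i1 (P i1).-1) ?prednK// e bt_tow ?prednK.
Qed.

(** Climb to the top, follow from top to ground floor a path of [A] to the
    target tower, and climb there to the target floor.  The path of [A] is
    nonempty, so that the target floor may be lower than the initial one in the
    same tower. *)
Lemma tower_mx_irreducible : irreducible_mx A -> irreducible_mx tower_mx.
Proof.
move=> Airr; pose conn b c := exists2 n, (1 <= n)%N & (0 < (tower_mx ^+ n)%R b c)%N.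
have conn1 b c : tower_edge b c -> conn b c.
  by move=> e; exists 1%N => //; rewrite expr1 mxE e.
have connT c b d : conn b c -> conn c d -> conn b d.
  move=> [m m0 Bm] [n n0 Bn]; exists (m + n)%N; first by rewrite addn_gt0 m0.
  exact: exprD_gt0 Bm Bn.
have climb j k l : (l < P j)%N -> (k < l)%N -> conn (bt j k) (bt j l).
  elim: l => [//|l IHl] lP; rewrite ltnS leq_eqVlt.
  have lP' : (l < P j)%N by exact: ltnW.
  have e : tower_edge (bt j l) (bt j l.+1).
    by rewrite /tower_edge !bt_tow// !bt_ht// lP !eqxx.
  case/orP => [/eqP->|kl]; first exact: conn1.
  exact: connT (IHl lP' kl) (conn1 _ _ e).
have climb0 j l : (l < P j)%N -> l = 0%N \/ conn (bt j 0) (bt j l).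
  by case: l => [|l] lP; [left|right; exact: climb].
have cross i j k : A i j = 1%N -> (k < P i)%N -> conn (bt i k) (bt j 0).
  move=> Aij kP; have lt_top : ((P i).-1 < P i)%N by rewrite prednK.
  have e : tower_edge (bt i (P i).-1) (bt j 0).
    by rewrite /tower_edge !bt_tow// !bt_ht// prednK// ltnn Aij.
  case: (ltngtP k (P i).-1) => [lt_k|gt_k|->]; last exact: conn1.
    exact: connT (climb _ _ _ lt_top lt_k) (conn1 _ _ e).
  by lia.
have walk n i j k : (0 < (A ^+ n.+1)%R i j)%N -> (k < P i)%N ->
    conn (bt i k) (bt j 0).
  elim: n j => [|n IHn] j.
    by rewrite expr1 => /(entry_gt0 A01); exact: cross.
  move=> /exprS_gt0[l [Ail /(entry_gt0 A01) Alj]] kP.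
  exact: connT (IHn _ Ail kP) (cross _ _ _ Alj (P_gt0 l)).
move=> b c; rewrite -/(conn b c) -(btK b) -(btK c).
have [[//|n] _ Abc] := Airr (tow b) (tow c).
have bc := walk _ _ _ _ Abc (ht_lt b).
by have [->|] := climb0 _ _ (ht_lt c); [|exact: connT].
Qed.

(** * From sequences of letters to itineraries in the towers *)

(** In a state [(m, k)] the itinerary of [x] is on floor [k] of the tower of the
    letter [x m].  Keeping the position [m] rather than the rest of the sequence
    makes it visible how much of [x] has been read. *)
Definition tower_step (x : nat -> 'I_N) (q : nat * nat) : nat * nat :=
  if (q.2.+1 < P (x q.1))%N then (q.1, q.2.+1) else (q.1.+1, 0%N).

Definition itinerary (x : nat -> 'I_N) (q : nat * nat) (t : nat) : 'I_M :=
  let q' := iter t (tower_step x) q in bt (x q'.1) q'.2.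

Lemma tower_step_valid x q : (q.2 < P (x q.1))%N ->
  ((tower_step x q).2 < P (x (tower_step x q).1))%N.
Proof. by rewrite /tower_step; case: ifP => //= _ _; rewrite P_gt0. Qed.

Lemma iter_step_valid x q t : (q.2 < P (x q.1))%N ->
  ((iter t (tower_step x) q).2 < P (x (iter t (tower_step x) q).1))%N.
Proof. by move=> ?; elim: t => //= t IHt; exact: tower_step_valid. Qed.

Lemma itinerary_admissible x q : admissible A x -> (q.2 < P (x q.1))%N ->
  admissible tower_mx (itinerary x q).
Proof.
move=> adx vq t; apply/tower_mxP; rewrite /itinerary iterS.
have := iter_step_valid t vq; case: (iter t _ q) => m k /= vm.
have := @tower_step_valid x (m, k) vm.
rewrite /tower_edge [tow (bt (x m) k)]bt_tow// [ht (bt (x m) k)]bt_ht//.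
rewrite /tower_step /=.
by case: ifP => /= lt_k vm'; rewrite bt_tow// bt_ht// ?adx !eqxx.
Qed.

Lemma iter_step_top x m k : (k < P (x m))%N ->
  iter (P (x m) - k) (tower_step x) (m, k) = (m.+1, 0%N).
Proof.
move=> kP; have [d dE] : exists d, (P (x m) - k = d.+1)%N.
  by exists (P (x m) - k).-1; lia.
rewrite dE; elim: d k kP dE => [|d IHd] k kP dE.
  by rewrite /= /tower_step /=; case: ifP => //; lia.
rewrite iterSr {2}/tower_step /=; case: ifP => lt_k; last by lia.
by apply: IHd => //; lia.
Qed.

Lemma iter_step_shift x m k t :
  iter t (tower_step x) (m.+1, k) =
  let q := iter t (tower_step (fun i => x i.+1)) (m, k) in (q.1.+1, q.2).
Proof.
elim: t => //= t ->; case: (iter t _ _) => m' k'.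
by rewrite /tower_step /=; case: ifP.
Qed.

Lemma itinerary_shift x m k :
  itinerary (fun i => x i.+1) (m, k) = itinerary x (m.+1, k).
Proof. by apply/funext => t; rewrite /itinerary iter_step_shift. Qed.

Lemma itinerary_iter x q s t :
  itinerary x q (s + t) = itinerary x (iter s (tower_step x) q) t.
Proof. by rewrite /itinerary addnC iterD. Qed.

Lemma iter_step_mono x q s t : (s <= t)%N ->
  ((iter s (tower_step x) q).1 <= (iter t (tower_step x) q).1)%N.
Proof.
move=> /subnKC <-; elim: (t - s)%N => [|d IHd]; first by rewrite addn0.
by rewrite addnS (leq_trans IHd)//= {2}/tower_step; case: ifP => //=.
Qed.

Lemma iter_step_eq x x' q t :
  (forall i, (i <= (iter t (tower_step x) q).1)%N -> x i = x' i) ->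
  iter t (tower_step x) q = iter t (tower_step x') q.
Proof.
elim: t => //= t IHt eqx.
have le_t := @iter_step_mono x q t t.+1 (leqnSn t).
rewrite -IHt; last by move=> i le_i; apply: eqx; exact: leq_trans le_i le_t.
by rewrite /tower_step -eqx.
Qed.

(** A step that moves to the next tower adds [p] to the left-hand side, but
    also loses the [P j - 1 >= p - 1] floors climbed in the tower that it
    leaves. *)
Lemma iter_step_slow p x q t : (forall j, (p <= P j)%N) ->
  let q' := iter t (tower_step x) q in
  (p * q'.1 + q'.2 <= t + p * q.1 + q.2)%N.
Proof.
move=> pP; elim: t => //= t; case: (iter t _ q) => m k /=.
rewrite /tower_step /=; have := pP (x m); case: ifP => /=; lia.
Qed.

(** The vertices visited show the letter read at each state, hence the next
    state; by induction equal itineraries pass through the same states, and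
    these read every letter from position [n] on. *)
Lemma itinerary_inj x x' n k k' : (k < P (x n))%N -> (k' < P (x' n))%N ->
  itinerary x (n, k) = itinerary x' (n, k') ->
  k = k' /\ forall i, (n <= i)%N -> x i = x' i.
Proof.
move=> kP kP' eq_it.
have same t : iter t (tower_step x) (n, k) = iter t (tower_step x') (n, k') ->
    x (iter t (tower_step x) (n, k)).1 = x' (iter t (tower_step x) (n, k)).1.
  move=> e; have := congr1 (fun z => tow (z t)) eq_it; rewrite /itinerary.
  have := @iter_step_valid x (n, k) t kP.
  have := @iter_step_valid x' (n, k') t kP'.
  by rewrite -e => v' v; rewrite !bt_tow.
have ek : k = k'.
  by have := congr1 (fun z => ht (z 0%N)) eq_it; rewrite /itinerary/= !bt_ht.
have eq_iter t : iter t (tower_step x) (n, k) = iter t (tower_step x') (n, k').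
  elim: t => [|t IHt] /=; first by rewrite ek.
  by rewrite -IHt /tower_step same.
split=> // i /subnKC <-.
suff [t tE] : exists t, (iter t (tower_step x) (n, k)).1 = (n + (i - n))%N.
  by rewrite -tE same.
elim: (i - n)%N => [|d [t tE]]; first by exists 0%N; rewrite addn0.
have := @iter_step_top x _ _ (@iter_step_valid x (n, k) t kP).
set q := iter t _ _; rewrite -surjective_pairing -iterD => e.
by exists (P (x q.1) - q.2 + t)%N; rewrite e /= addnS -tE.
Qed.

(** * From itineraries back to sequences of letters *)

(** The next date after [t] at which [z] is on a ground floor. *)
Definition next_floor0 (z : nat -> 'I_M) (t : nat) : nat :=
  (t + (P (tow (z t)) - ht (z t)))%N.

(** The successive towers that [z] visits. *)
Definition read (z : nat -> 'I_M) (i : nat) : 'I_N :=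
  tow (z (iter i (next_floor0 z) 0)).

Lemma climbing z t d : admissible tower_mx z ->
  (ht (z t) + d < P (tow (z t)))%N ->
  tow (z (t + d)) = tow (z t) /\ ht (z (t + d)) = (ht (z t) + d)%N.
Proof.
move=> adz; elim: d => [|d IHd] lt_d; first by rewrite !addn0.
have [|e1 e2] := IHd; first by lia.
have /tower_mxP := adz (t + d)%N.
rewrite /tower_edge e1 e2 -addnS lt_d => /andP[/eqP e1' /eqP e2'].
by rewrite addnS.
Qed.

Lemma next_floor0P z t : admissible tower_mx z ->
  A (tow (z t)) (tow (z (next_floor0 z t))) = 1%N /\
  ht (z (next_floor0 z t)) = 0%N.
Proof.
move=> adz; have lt_t := ht_lt (z t).
have [|e1 e2] := @climbing z t (P (tow (z t)) - ht (z t)).-1 adz; first by lia.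
have /tower_mxP := adz (t + (P (tow (z t)) - ht (z t)).-1)%N.
rewrite /tower_edge e1 e2; case: ifP => [|_]; first by lia.
rewrite -addnS prednK ?subn_gt0//.
by move=> /andP[/eqP ? /eqP ?].
Qed.

Lemma read_admissible z : admissible tower_mx z -> admissible A (read z).
Proof.
move=> adz i; rewrite /read iterS.
by have [] := next_floor0P (iter i (next_floor0 z) 0) adz.
Qed.

(** At a date [t] between the [i]-th and the next arrival on a ground floor, the
    itinerary is in the [i]-th tower and has climbed [t - tau i] floors since
    the date [tau i]. *)
Lemma itinerary_read z x n : admissible tower_mx z ->
  (forall i, x (n + i)%N = read z i) -> itinerary x (n, ht (z 0%N)) = z.
Proof.
move=> adz xE; apply/funext => t.
pose tau i := iter i (next_floor0 z) 0%N.
suff [i [tE sE]] : exists i, (tau i <= t < next_floor0 z (tau i))%N /\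
    iter t (tower_step x) (n, ht (z 0%N)) =
      ((n + i)%N, (ht (z (tau i)) + (t - tau i))%N).
  case/andP: tE => tE1; rewrite /next_floor0 => tE2.
  have [|] := @climbing z (tau i) (t - tau i) adz; first by lia.
  by rewrite subnKC// => e1 e2; rewrite /itinerary sE /= xE -(bt_eq e1 e2).
elim: t => [|t [i [tE sE]]].
  exists 0%N; rewrite /= addn0 subn0 addn0; split=> //.
  by rewrite /tau /next_floor0 /= add0n subn_gt0 ht_lt.
rewrite iterS sE /tower_step /= xE /read -/(tau i).
have := ht_lt (z (tau i)); move: tE; rewrite /next_floor0.
case: ifP => lt_t /andP[tE1 tE2] ltP.
  by exists i; split; [apply/andP; split; lia|congr pair; lia].
have e : tau i.+1 = t.+1 by rewrite /tau iterS -/(tau i) /next_floor0; lia.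
exists i.+1; rewrite e; split; last first.
  have [_ h0] := next_floor0P (tau i) adz.
  by move: h0; rewrite -iterS -/(tau i.+1) e addnS subnn addn0 => ->.
by rewrite leqnn /next_floor0; have := ht_lt (z t.+1); lia.
Qed.

Lemma next_floor0_shift z i t :
  (iter i (next_floor0 (fun s => z s.+1)) t).+1 = iter i (next_floor0 z) t.+1.
Proof. by elim: i => //= i <-; rewrite /next_floor0 addSn. Qed.

(** Forgetting the first vertex forgets a tower only if that vertex is its
    top. *)
Lemma read_shift z : admissible tower_mx z -> forall i,
  read (fun s => z s.+1) i =
  read z (if ((ht (z 0%N)).+1 < P (tow (z 0%N)))%N then i else i.+1).
Proof.
move=> adz i; rewrite /read next_floor0_shift.
have /tower_mxP := adz 0%N; rewrite /tower_edge; case: ifP => top.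
  move=> /andP[/eqP e1 /eqP e2]; case: i => [|i] /=; first by [].
  by rewrite -!iterS !iterSr {2 4}/next_floor0 e1 e2; congr (tow (z (iter _ _ _))); lia.
move=> _; rewrite iterSr {3}/next_floor0; congr (tow (z (iter _ _ _))).
by have := ht_lt (z 0%N); lia.
Qed.

Lemma read_local K z z' i : (forall j, (P j <= K)%N) ->
  (forall t, (t <= i * K)%N -> z t = z' t) -> read z i = read z' i.
Proof.
move=> PK eqz.
suff [e le_i] : iter i (next_floor0 z) 0%N = iter i (next_floor0 z') 0%N /\
    (iter i (next_floor0 z) 0%N <= i * K)%N.
  by rewrite /read -e eqz.
elim: i eqz => //= i IHi eqz.
have [|e le_i] := IHi; first by move=> t le_t; apply: eqz; rewrite mulSn; lia.
rewrite -e; set t := iter i _ 0%N in le_i *; have := PK (tow (z t)).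
by rewrite /next_floor0 -eqz mulSn; [lia|lia].
Qed.

End Towers.

(** * The topology of Markov shifts *)

Definition agree (T : Type) (n : nat) (x y : nat -> T) : Prop :=
  forall i, (i < n)%N -> x i = y i.

Section MarkovTopology.
Local Open Scope classical_set_scope.
Variables (N : nat) (A : 'M[nat]_N).
Local Notation X := (markov_space A).
Local Notation sq x := (val x : nat -> 'I_N).

Lemma sequences_cvg
    (g : nat -> prod_topology (fun _ : nat => discrete_topology 'I_N))
    (x : prod_topology (fun _ : nat => discrete_topology 'I_N)) :
  (forall n, agree n (g n : nat -> 'I_N) x) -> g @ \oo --> x.
Proof.
move=> gx; apply/cvg_sup => i U [V] [[W] oW <-] Wx WU.
apply: (filterS WU); exists i.+1 => // n /= lt_in.
by rewrite /= (gx n i).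
Qed.

Lemma filter_agree (F : set_system X) (a : nat -> 'I_N) : Filter F ->
  (forall i, F [set y : X | sq y i = a i]) ->
  forall n, F [set y : X | agree n (sq y) a].
Proof.
move=> FF Fa; elim=> [|n IHn]; first by apply: filterS filterT => y _ i.
apply: filterS2 IHn (Fa n) => y agn yn i.
by rewrite ltnS leq_eqVlt => /orP[/eqP->//|/agn].
Qed.

(** Cylinders form a basis of neighbourhoods.  A neighbourhood of [x] containing
    no cylinder would miss a sequence of points converging to [x]. *)
Lemma nbhs_markovP (x : X) (W : set X) :
  nbhs x W <-> exists n, forall y : X, agree n (sq y) (sq x) -> W y.
Proof.
split=> [|[n nW]].
  rewrite nbhsE => -[U [[V oV <-] Vx] UW]; apply: contrapT => noW.
  have bad n : exists y : X, agree n (sq y) (sq x) /\ ~ W y.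
    apply: contrapT => nbad; apply: noW; exists n => y yx.
    by apply: contrapT => nWy; apply: nbad; exists y.
  have [g gP] := choice bad.
  have gx : (fun n => val (g n)) @ \oo --> val x.
    by apply: sequences_cvg => n; have [] := gP n.
  have /gx [n _ gV] : nbhs (val x) V by apply: open_nbhs_nbhs.
  by have [_] := gP n; apply; apply: UW; exact: (gV n (leqnn n)).
have coord i : nbhs x [set y : X | sq y i = sq x i].
  have coord_continuous :
      continuous (fun y : X => val y i : discrete_topology 'I_N).
    move=> y; apply: (@continuous_comp _ _ _ (val : X -> _) (proj i)).
      exact: initial_continuous.
    exact: (@proj_continuous nat (fun _ => discrete_topology 'I_N)).
  by apply: (coord_continuous x [set a | a = val x i]); exact: discrete_set1.
by apply: filterS nW _; exact: filter_agree.
Qed.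

Lemma continuous_nat (k : X -> nat) n :
  (forall x y : X, agree n (sq y) (sq x) -> k y = k x) -> continuous k.
Proof.
move=> kP x U /nbhs_singleton Ux; apply/nbhs_markovP; exists n => y yx /=.
by rewrite (kP _ _ yx).
Qed.

(** Along an ultrafilter each letter is eventually constant, the alphabet being
    finite; the limit letters form an admissible sequence. *)
Lemma markov_space_compact : compact [set: X].
Proof.
rewrite compact_ultra => F FU _.
have limit i : exists a, F [set y : X | sq y i = a].
  apply: contrapT => nolim.
  have : F [set y : X | forall a, sq y i <> a].
    apply: (@filter_forall _ _ (fun a (y : X) => sq y i <> a)) => a.
    by have [Fa|] := in_ultra_setVsetC [set y : X | sq y i = a] FU; first by
      case: nolim; exists a.
  by move=> /filter_ex[y /(_ (sq y i))].
have [a aP] := choice limit.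
have adm : markov_space A a.
  move=> n; have [y [yn ynS]] := filter_ex (filterI (aP n) (aP n.+1)).
  by rewrite -yn -ynS; have /set_mem := valP y.
exists (exist _ a (mem_set adm)); split=> // W /nbhs_markovP[n nW].
by apply: filterS nW _; exact: filter_agree.
Qed.

(** The Lebesgue number lemma, for cylinders in place of balls: if for each [s]
    some [g s] had no cylinder of length [s] inside a member of the cover, then
    a cluster point of [g] could not be covered. *)
Lemma lebesgue_number (U : set (set X)) : open_cover U ->
  exists s, forall x : X,
    exists2 W, U W & forall y : X, agree s (sq y) (sq x) -> W y.
Proof.
move=> [Uo Ucov]; apply: contrapT => noleb.
have bad s : exists x : X,
    ~ exists2 W, U W & forall y : X, agree s (sq y) (sq x) -> W y.
  apply: contrapT => nbad; apply: noleb; exists s => x.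
  by apply: contrapT => nx; apply: nbad; exists x.
have [g gP] := choice bad.
have [|x [_ clx]] := markov_space_compact (F := g @ \oo).
  by apply: filterS filterT.
have [W UW Wx] : (\bigcup_(W in U) W) x by rewrite Ucov.
have /nbhs_markovP[n nW] : nbhs x W by apply: open_nbhs_nbhs; split=> //; exact: Uo.
have near_x : nbhs x [set y : X | agree n (sq y) (sq x)].
  by apply/nbhs_markovP; exists n.
have tail : (g @ \oo) [set g s | s in [set s | (n <= s)%N]].
  by exists n => // s /= le_ns; exists s.
have [_ [[s le_ns <-] gx]] := clx _ _ tail near_x.
apply: (gP s); exists W => // y ygs; apply: nW => i lt_in.
by rewrite ygs ?gx// (leq_trans lt_in).
Qed.

End MarkovTopology.

Lemma continuous_markov (N M : nat) (A : 'M[nat]_N) (B : 'M[nat]_M)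
    (f : markov_space A -> markov_space B) :
  (forall t, exists n, forall x y : markov_space A,
     agree n (val y : nat -> 'I_N) (val x) ->
     agree t (val (f y) : nat -> 'I_M) (val (f x))) ->
  continuous f.
Proof.
move=> fP x U /nbhs_markovP[t tU]; have [n nP] := fP t.
by apply/nbhs_markovP; exists n => y yx /=; apply: tU; exact: nP.
Qed.

(** * Entropy and the number of cylinders *)

Section Entropy.
Local Open Scope classical_set_scope.
Local Open Scope ring_scope.
Local Open Scope ereal_scope.
Variable R : realType.

(** One member of the cover suffices for each value of the code. *)
Lemma cover_number_le (T : Type) (U : set (set T)) (I : finType)
    (code : T -> I) :
  (forall z, exists2 W, U W & forall z', code z' = code z -> W z') ->
  cover_number R U <= (#|I|%:R)%:E.
Proof.
move=> codeU.
have pick u : exists W, forall z, code z = u ->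
    U W /\ forall z', code z' = u -> W z'.
  have [[z <-]|no] := pselect (exists z, code z = u).
    by have [W UW zW] := codeU z; exists W.
  by exists setT => z zu; case: no; exists z.
have [G GP] := choice pick.
pose V := G @` range code.
have VI : (V #<= `I_#|I|)%card.
  rewrite (card_le_eqr card_II).
  apply: card_le_trans (card_image_le (fun i : 'I_#|I| => G (enum_val i)) setT).
  apply: subset_card_le => _ [u _ <-].
  by exists (enum_rank u) => //; rewrite enum_rankK.
have [n Vn] : finite_set V by apply: card_le_finite VI _; exact: finite_II.
apply: (@le_trans _ _ (n%:R)%:E); last first.
  by rewrite lee_fin ler_nat -card_le_II -(card_le_eql Vn).
apply: ereal_inf_lbound; exists n => //; exists V; split=> //.
  by move=> _ [_ [z _ <-] <-]; have [] := GP _ z erefl.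
apply/seteqP; split=> // z _; exists (G (code z)).
  by exists (code z) => //; exists z.
by have [_] := GP _ z erefl; apply.
Qed.

Lemma cover_number_ge0 (T : Type) (U : set (set T)) : 0 <= cover_number R U.
Proof. by apply: le_ereal_inf_tmp => _ [n _ <-]; rewrite lee_fin. Qed.

Lemma limn_esup_le (u : nat -> \bar R) (l : \bar R) n :
  (forall t, (n <= t)%N -> u t <= l) -> limn_esup u <= l.
Proof.
move=> ul; apply: (@le_trans _ _ (ereal_sup (u @` [set t | (n <= t)%N]))).
  by apply: ereal_inf_lbound; exists [set t | (n <= t)%N] => //; exists n.
by apply: ge_ereal_sup => _ [t /= le_nt <-]; exact: ul.
Qed.

Variables (N : nat) (A : 'M[nat]_N) (M : nat) (B : 'M[nat]_M).
Local Notation sqA x := (val (x : markov_space A) : nat -> 'I_N).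
Local Notation sqB x := (val (x : markov_space B) : nat -> 'I_M).

Lemma val_iter_shift i (z : markov_space B) t :
  sqB (iter i (@markov_shift M B) z) t = sqB z (i + t)%N.
Proof. by elim: i t => //= i IHi t; rewrite IHi addnS. Qed.

Lemma iterated_join_cylinder (U : set (set (markov_space B))) s t z :
  (forall x, exists2 W, U W & forall y, agree s (sqB y) (sqB x) -> W y) ->
  exists2 W, iterated_join (@markov_shift M B) U t W &
    forall y, agree (s + t) (sqB y) (sqB z) -> W y.
Proof.
move=> sU.
have pick i : exists W, U W /\
    forall y, agree s (sqB y) (sqB (iter i (@markov_shift M B) z)) -> W y.
  by have [W UW yW] := sU (iter i (@markov_shift M B) z); exists W.
have [W WP] := choice pick.
exists (\bigcap_(i in `I_t) (iter i (@markov_shift M B) @^-1` W i)).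
  by exists W => // i; have [] := WP i.
move=> y yz i /= lt_it; have [_] := WP i; apply=> j lt_js.
by rewrite !val_iter_shift yz// addnC -addSn leq_add// ltnW.
Qed.

(** If [n] letters of [f y] determine about [p * n] letters of [y], then for an
    open cover refined by the cylinders of length [s], the [t]-th iterated join
    is refined by the preimages under [f] of the cylinders of length about
    [(s + t) / p], of which there are at most [N ^ ((s + t) / p + const)]. *)
Lemma entropy_le (f : markov_space B -> markov_space A) (p C : nat) :
  (0 < p)%N -> (0 < N)%N ->
  (forall n t y z, (t + C <= p * n)%N -> agree n (sqA (f y)) (sqA (f z)) ->
    agree t (sqB y) (sqB z)) ->
  topological_entropy R (@markov_shift M B) <= (ln N%:R / p%:R)%:E.
Proof.
move=> p0 N0 fP; apply: ge_ereal_sup => _ [U Ucov <-].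
have [s sU] := lebesgue_number Ucov.
have lnN0 : (0 <= ln (N%:R : R))%R by rewrite ln_ge0// ler1n.
have count t : lne (cover_number R (iterated_join (@markov_shift M B) U t)) <=
    ((((s + t + C) %/ p).+1)%:R * ln N%:R)%:E.
  set q := ((s + t + C) %/ p).+1.
  have qP : (s + t + C <= p * q)%N by rewrite mulnC ltnW// ltn_ceil.
  pose code z : {ffun 'I_q -> 'I_N} := [ffun i : 'I_q => sqA (f z) i].
  have le_num : cover_number R (iterated_join (@markov_shift M B) U t) <=
      ((N ^ q)%:R)%:E.
    have := @cover_number_le _ (iterated_join (@markov_shift M B) U t) _ code.
    rewrite card_ffun !card_ord; apply=> z.
    have [W jW zW] := iterated_join_cylinder t z sU.
    exists W => // y /ffunP eq_code; apply: zW; apply: fP qP _ => i lt_iq.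
    by have := eq_code (Ordinal lt_iq); rewrite !ffunE.
  apply: (@le_trans _ _ (lne ((N ^ q)%:R)%:E)).
    by rewrite lee_lne// in_itv /= leey andbT ?cover_number_ge0// lee_fin.
  by rewrite lne_EFin ?ltr0n ?expn_gt0 ?N0// natrX lnXn ?ltr0n// mulr_natl.
apply/lee_addgt0Pr => e e0.
(* [D] bounds the part of [q * ln N] that does not grow with [t]; [D / t] is at
   most [e] as soon as [t >= D / e]. *)
pose D : R := (((s + C)%:R / p%:R + 1) * ln N%:R)%R.
apply: (@limn_esup_le _ _ (Num.truncn (D / e)).+1) => t le_t.
have t0 : (0 < t%:R :> R)%R by rewrite ltr0n; exact: leq_trans le_t.
apply: le_trans (lee_wpmul2l _ (count t)) _; first by rewrite lee_fin invr_ge0 ltW.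
rewrite -EFinM -EFinD lee_fin ler_pdivrMl//.
have De : (D <= t%:R * e)%R.
  rewrite -ler_pdivrMr//; apply: le_trans (ltW (truncnS_gt _)) _.
  by rewrite ler_nat.
have p0' : (0 < p%:R :> R)%R by rewrite ltr0n.
have le_q : ((((s + t + C) %/ p).+1)%:R <=
    (t%:R / p%:R + ((s + C)%:R / p%:R + 1)) :> R)%R.
  rewrite -addn1 natrD addrA lerD2r -mulrDl ler_pdivlMr// -natrD -natrM ler_nat.
  by rewrite (leq_trans (leq_divM _ _))//; lia.
apply: le_trans (ler_wpM2r lnN0 le_q) _.
rewrite mulrDl mulrDr lerD//.
by rewrite mulrAC mulrA.
Qed.

End Entropy.

(** * The orbit equivalence *)

Section Recoding.
Variables (N : nat) (A : 'M[nat]_N) (n p : nat).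
Local Notation P := (fun j => size (pasts A n j)).
Hypothesis p_gt0 : (0 < p)%N.
Hypothesis p_le : forall j, (p <= P j)%N.
Variables (M : nat) (tow : 'I_M -> 'I_N) (ht : 'I_M -> nat).
Variable bt : 'I_N -> nat -> 'I_M.
Hypothesis bt_tow : forall j k, (k < P j)%N -> tow (bt j k) = j.
Hypothesis bt_ht : forall j k, (k < P j)%N -> ht (bt j k) = k.
Hypothesis ht_lt : forall b, (ht b < P (tow b))%N.
Hypothesis btK : forall b, bt (tow b) (ht b) = b.

Local Notation B := (tower_mx A P tow ht).
Local Notation X := (markov_space A).
Local Notation Y := (markov_space B).
Local Notation sqA x := (val (x : X) : nat -> 'I_N).
Local Notation sqB z := (val (z : Y) : nat -> 'I_M).

Let P_gt0 j : (0 < P j)%N.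
Proof. exact: leq_trans p_gt0 (p_le j). Qed.

Lemma markov_admissible (x : X) : admissible A (sqA x).
Proof. exact: (set_mem (valP x)). Qed.

Lemma tower_admissible (z : Y) : admissible B (sqB z).
Proof. exact: (set_mem (valP z)). Qed.

Definition past_rank (x : nat -> 'I_N) : nat :=
  index (mkseq x n) (pasts A n (x n)).

Lemma past_rank_lt x : admissible A x -> (past_rank x < P (x n))%N.
Proof. by move=> adx; rewrite index_mem mkseq_pasts. Qed.

(** The letters from position [n] on tell the towers to visit, the [n] letters
    before them the floor of the first tower on which to start. *)
Definition recode (x : X) : Y :=
  exist _ (itinerary P bt (sqA x) (n, past_rank (sqA x)))
    (mem_set (itinerary_admissible bt_tow bt_ht P_gt0 (markov_admissible x)
                (q := (n, past_rank (sqA x))) (past_rank_lt (markov_admissible x)))).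

Definition read_past (z : nat -> 'I_M) : seq 'I_N :=
  nth [::] (pasts A n (tow (z 0%N))) (ht (z 0%N)).

Lemma read_past_mem z : read_past z \in pasts A n (tow (z 0%N)).
Proof. exact: mem_nth. Qed.

Definition unread (z : nat -> 'I_M) : nat -> 'I_N :=
  prepend (read_past z) (read P tow ht z).

Lemma unread_admissible z : admissible B z -> admissible A (unread z).
Proof.
move=> adz; apply: (@prepend_admissible _ _ n).
  by apply: read_admissible.
exact: read_past_mem.
Qed.

Lemma unread_read z i : unread z (n + i) = read P tow ht z i.
Proof.
rewrite /unread /prepend (size_mem_pasts (read_past_mem z)).
by rewrite ltnNge leq_addr /= addKn.
Qed.

Lemma unread_rank z : past_rank (unread z) = ht (z 0%N).
Proof.
have sz := size_mem_pasts (read_past_mem z).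
have -> : past_rank (unread z) = index (read_past z) (pasts A n (tow (z 0%N))).
  rewrite /past_rank -[X in unread z X]addn0 unread_read; congr index.
  apply: (@eq_from_nth _ (tow (z 0%N))); rewrite size_mkseq ?sz// => i lt_in.
  rewrite nth_mkseq// /unread /prepend sz lt_in.
  by apply: set_nth_default; rewrite sz.
by rewrite index_uniq// pasts_uniq.
Qed.

Definition unrecode (z : Y) : X :=
  exist _ (unread (sqB z)) (mem_set (unread_admissible (tower_admissible z))).

Lemma unrecodeK : cancel unrecode recode.
Proof.
move=> z; apply: val_inj; rewrite /= unread_rank.
apply: itinerary_read => //; first exact: tower_admissible.
by move=> i; rewrite unread_read.
Qed.

Lemma recode_inj : injective recode.
Proof.
move=> x y /(congr1 val) /=.
have rx := past_rank_lt (markov_admissible x).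
have ry := past_rank_lt (markov_admissible y).
move=> /(itinerary_inj bt_tow bt_ht P_gt0 rx ry)[eq_rank eq_tail].
have eq_past : mkseq (sqA x) n = mkseq (sqA y) n.
  rewrite -(nth_index [::] (mkseq_pasts n (markov_admissible x))).
  rewrite -(nth_index [::] (mkseq_pasts n (markov_admissible y))).
  by rewrite -/(past_rank _) eq_rank eq_tail.
apply: val_inj; apply/funext => i; case: (leqP n i) => [/eq_tail//|lt_in].
by have := congr1 (fun s => nth (sqA x 0%N) s i) eq_past; rewrite !nth_mkseq.
Qed.

Lemma recodeK : cancel recode unrecode.
Proof. by move=> x; apply: recode_inj; rewrite unrecodeK. Qed.

Variable K : nat.
Hypothesis P_le : forall j, (P j <= K)%N.

(** By [iter_step_slow], in [t] steps [recode x] reads no letter beyond position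
    [(t + p * n + K) / p]; the [K] covers the floor on which it starts. *)
Lemma recode_local q t x y : (t + (p * n + K) <= p * q)%N ->
  agree q (sqA x) (sqA y) -> agree t (sqB (recode x)) (sqB (recode y)).
Proof.
move=> tq xy s lt_st.
have lt_nq : (n < q)%N by rewrite -(ltn_pmul2l p_gt0); lia.
have eq_n := xy n lt_nq.
have eq_rank : past_rank (sqA x) = past_rank (sqA y).
  rewrite /past_rank eq_n; congr index; apply/eq_in_map => i.
  by rewrite mem_iota => /andP[_ lt_in]; apply: xy; exact: ltn_trans lt_nq.
have eq_x i : (i <= (iter s (tower_step P (sqA x)) (n, past_rank (sqA x))).1)%N ->
    sqA x i = sqA y i.
  move=> le_i; apply: xy; apply: leq_ltn_trans le_i _; rewrite -(ltn_pmul2l p_gt0).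
  have := @iter_step_slow _ P p (sqA x) (n, past_rank (sqA x)) s p_le.
  have := past_rank_lt (markov_admissible x); have := P_le (sqA x n).
  by move: lt_st tq => /=; lia.
by rewrite /= /itinerary -eq_rank -(iter_step_eq eq_x) eq_x.
Qed.

Lemma recode_continuous : continuous recode.
Proof.
apply: continuous_markov => t; exists (t + (p * n + K))%N => x y.
by apply: recode_local; rewrite leq_pmull.
Qed.

Lemma unrecode_continuous : continuous unrecode.
Proof.
apply: continuous_markov => t; exists (t * K).+1 => x y yx i lt_it.
have eq_read j : (j <= t)%N -> read P tow ht (sqB y) j = read P tow ht (sqB x) j.
  move=> le_jt; apply: (@read_local _ P _ tow ht K) => // s le_s; apply: yx.
  by rewrite ltnS (leq_trans le_s)// leq_mul2r le_jt orbT.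
rewrite /= /unread /prepend /read_past yx// eq_read//.
by rewrite eq_read// (leq_trans (leq_subr _ _))// ltnW.
Qed.

(** Both [recode x] and [recode (shift x)] visit, in this order, the towers of
    the letters of [x] from position [n.+1] on, the former after the tower of
    [x n]; but the latter may start in the middle of the tower of [x n.+1].  They
    agree from the ground floor of the tower of [x n.+2] on; [l1] and [k1] are
    the times to get there.  Conversely, dropping the [n] letters of the past
    from [unrecode z] leaves the sequence of towers that [z] visits, which
    shifting [z] changes only if [z] starts at the top of a tower. *)
Lemma recode_orbit_equivalence : continuously_orbit_equivalent A B.
Proof.
pose k1 (x : X) := (P (sqA x n.+1) - past_rank (fun i => sqA x i.+1))%N.
pose l1 (x : X) := (P (sqA x n.+1) + (P (sqA x n) - past_rank (sqA x)))%N.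
pose l2 (z : Y) :=
  (n + ~~ ((ht (sqB z 0%N)).+1 < P (tow (sqB z 0%N))))%N.
have past_eq m x y : agree (m + n.+1) (sqA y) (sqA x) ->
    past_rank (fun i => sqA y (m + i)%N) = past_rank (fun i => sqA x (m + i)%N).
  move=> yx; rewrite /past_rank yx ?ltn_add2l//; congr index.
  apply/eq_in_map => i; rewrite mem_iota => /andP[_ lt_in]; apply: yx.
  by rewrite ltn_add2l; exact: ltnW.
exists recode, unrecode, k1, l1, (fun=> n), l2; split.
  split; [exact: recodeK|exact: unrecodeK|exact: recode_continuous|].
  exact: unrecode_continuous.
split.
  split.
  - apply: (@continuous_nat _ _ _ n.+2) => x y yx.
    by rewrite /k1 yx// (past_eq 1%N x y).
  - apply: (@continuous_nat _ _ _ n.+2) => x y yx.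
    by rewrite /l1 !yx// (past_eq 0%N x y)// => i lt_i; apply: yx; lia.
  - exact: (@continuous_nat _ _ _ 0).
  - by apply: (@continuous_nat _ _ _ 1) => x y yx; rewrite /l2 yx.
split=> [x|z]; apply: val_inj; apply/funext => t; rewrite !val_iter_shift /=.
- have adx := markov_admissible x.
  have adSx : admissible A (fun i => sqA x i.+1) by move=> i; exact: adx.
  have top1 := @iter_step_top _ P (sqA x) n.+1 _ (past_rank_lt adSx).
  have top0 := @iter_step_top _ P (sqA x) n _ (past_rank_lt adx).
  have := @iter_step_top _ P (sqA x) n.+1 0 (P_gt0 _); rewrite subn0 => top.
  rewrite (itinerary_shift _ _ (sqA x)) !itinerary_iter.
  by rewrite /k1 /l1 iterD top1 top0 top.
- have adz := tower_admissible z.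
  rewrite /l2 -addnA !unread_read (read_shift ht_lt adz).
  by case: ifP => _; rewrite ?add0n ?add1n.
Qed.

End Recoding.

Theorem theorem3p8 (R : realType) (N : nat) (A : 'M[nat]_N)
    (A01 : zero_one_mx A) (Airr : irreducible_mx A) (Anperm : ~~ is_perm_mx A)
    (r : R) (r_gt0 : (0 < r)%R) :
  exists (M : nat) (B : 'M[nat]_M),
    [/\ zero_one_mx B, irreducible_mx B & ~~ is_perm_mx B] /\
    continuously_orbit_equivalent A B /\
    (topological_entropy R (@markov_shift M B) < r%:E)%E.
Proof.
have [i0 _] := nonperm_two_preds A01 Airr Anperm.
have N_gt0 : (0 < N)%N by exact: leq_ltn_trans (ltn_ord i0).
(* The least integer exceeding [ln N / r], so that [ln N / p < r]. *)
pose p := (Num.truncn (ln N%:R / r)%R).+1.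
have p_gt0 : (0 < p)%N by [].
have [n p_le] := pasts_unbounded A01 Airr Anperm p.
have P_gt0 j : (0 < size (pasts A n j))%N by exact: leq_trans p_gt0 (p_le j).
pose K := (\max_j size (pasts A n j))%N.
have P_le j : (size (pasts A n j) <= K)%N.
  exact: (leq_bigmax (F := fun j => size (pasts A n j))).
have [M [tow [ht [bt [bt_tow bt_ht ht_lt btK]]]]] :=
  @tower_coding _ (fun j => size (pasts A n j)) i0 (P_gt0 i0).
exists M, (tower_mx A (fun j => size (pasts A n j)) tow ht); split; [|split].
- split; first exact: tower_mx01.
  + exact: (tower_mx_irreducible bt_tow bt_ht).
  + exact: (tower_mx_nonperm bt_tow bt_ht).
- exact: (recode_orbit_equivalence p_gt0 p_le bt_tow bt_ht ht_lt btK P_le).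
apply: le_lt_trans (_ : _ <= (ln N%:R / p%:R)%:E)%E _; last first.
  rewrite lte_fin ltr_pdivrMr ?ltr0n// mulrC -ltr_pdivrMr//.
  exact: truncnS_gt.
apply: (@entropy_le _ _ _ _ _ (unrecode ht_lt) p (p * n + K)) => //.
move=> q t y z le_q yz s lt_st.
rewrite -(unrecodeK p_gt0 p_le bt_tow bt_ht ht_lt btK y).
rewrite -(unrecodeK p_gt0 p_le bt_tow bt_ht ht_lt btK z).
exact: (recode_local p_gt0 p_le bt_tow bt_ht P_le le_q yz).
Qed.
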